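(* Let $\boldsymbol{P}$ be a permutation matrix of order $K$. The Gaussian distribution $\mathcal{N}(\boldsymbol{w}_0,\boldsymbol{P}_0)$ of $\boldsymbol{P}$-invariant tensors is described by a mean vector $\boldsymbol{w}_0$ that is $\boldsymbol{P}$-invariant and covariance matrix $$\boldsymbol{P}_0=\frac{\boldsymbol{P}+\boldsymbol{P}^2+\cdots+\boldsymbol{P}^K}{K}.$$
   Context: Here $\boldsymbol{P}\in\mathbb{R}^{J^D\times J^D}$. The order $K$ of a permutation matrix $\boldsymbol{P}$ is the smallest natural number such that $\boldsymbol{P}^K=\boldsymbol{I}$. A tensor $\mathcal{W}\in\mathbb{R}^{J\times\cdots\times J}$ ($D$ modes, a $D$-dimensional real array) with vectorization $\boldsymbol{w}=\mathrm{vec}(\mathcal{W})\in\mathbb{R}^{J^D}$ is called $\boldsymbol{P}$-invariant if $\boldsymbol{P}\boldsymbol{w}=\boldsymbol{w}$; a vector $\boldsymbol{w}_0\in\mathbb{R}^{J^D}$ is likewise $\boldsymbol{P}$-invariant if $\boldsymbol{P}\boldsymbol{w}_0=\boldsymbol{w}_0$. $\mathcal{N}(\boldsymbol{w}_0,\boldsymbol{P}_0)$ denotes the Gaussian distribution of the vectorization $\boldsymbol{w}$ with mean vector $\boldsymbol{w}_0$ and covariance matrix $\boldsymbol{P}_0$. *)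

(* Defs.v *)
From HB Require Import structures.
From mathcomp Require Import all_boot all_order all_algebra.
From mathcomp Require Import all_classical all_reals all_analysis.

Set Implicit Arguments.
Unset Strict Implicit.
Unset Printing Implicit Defensive.

Import Order.TTheory GRing.Theory Num.Theory.
Import numFieldNormedType.Exports.

Local Open Scope classical_set_scope.
Local Open Scope ring_scope.

Definition tensor (R : Type) (J D : nat) : Type :=
  {ffun {ffun 'I_D -> 'I_J} -> R}.

Lemma digit_subproof (J D : nat) (i : 'I_(J ^ D)) (k : 'I_D) :
  ((i %/ J ^ k) %% J < J)%N.
Proof.
rewrite ltn_mod; case: J i => [[i]|//].
by rewrite exp0n ?(leq_ltn_trans (leq0n k) (ltn_ord k)).
Qed.

(* Column-major (first mode fastest) numbering of the entries: the position
   i = \sum_k j_k * J ^ k corresponds to the multi-index (j_0, j_1, ...). *)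
Definition multi_index (J D : nat) (i : 'I_(J ^ D)) : {ffun 'I_D -> 'I_J} :=
  [ffun k => Ordinal (digit_subproof i k)].

Definition vec (R : Type) (J D : nat) (W : tensor R J D) : 'cV[R]_(J ^ D) :=
  \col_(i < J ^ D) W (multi_index i).

Definition invariant_vector (R : realType) (n : nat)
    (P : 'M[R]_n) (w : 'cV[R]_n) : Prop :=
  P *m w = w.

Definition invariant_tensor (R : realType) (J D : nat)
    (P : 'M[R]_(J ^ D)) (W : tensor R J D) : Prop :=
  invariant_vector P (vec W).

Definition has_order (R : realType) (n : nat) (P : 'M[R]_n) (K : nat) : Prop :=
  [/\ (0 < K)%N, P ^+ K = 1%:M
    & forall k : nat, (0 < k)%N -> P ^+ k = 1%:M -> (K <= k)%N].

(* normal_prob a 0 is a junk value (the uniform law on [0, 1]), whereas the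
   Gaussian law with zero variance is the point mass at a. *)
Definition normal_law (R : realType) (a s : R) : set R -> \bar R :=
  if s == 0 then dirac a else normal_prob a s.

(* X ~ N(m, S), where S may be singular: every linear functional of X has a
   possibly degenerate normal law, the mean vector of X is m and its covariance
   matrix is S. *)
Definition gaussian_vector (d : measure_display) (T : measurableType d)
    (R : realType) (Pr : probability T R) (n : nat)
    (X : T -> 'cV[R]_n) (m : 'cV[R]_n) (S : 'M[R]_n) : Prop :=
  [/\ forall i : 'I_n, measurable_fun [set: T] (fun t => X t i 0),
      forall u : 'cV[R]_n, exists a s : R, forall A : set R, measurable A ->
        Pr ((fun t => (u^T *m X t) 0 0) @^-1` A) = normal_law a s A,
      forall i : 'I_n, 'E_Pr[(fun t => X t i 0)%R]%E = (m i 0)%:E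
    & forall i j : 'I_n,
        covariance Pr (fun t => X t i 0) (fun t => X t j 0) = (S i j)%:E].

Definition gaussian_tensor (d : measure_display) (T : measurableType d)
    (R : realType) (Pr : probability T R) (J D : nat)
    (W : T -> tensor R J D) (m : 'cV[R]_(J ^ D)) (S : 'M[R]_(J ^ D)) : Prop :=
  gaussian_vector Pr (fun t => vec (W t)) m S.

Definition power_mean (R : realType) (n : nat) (P : 'M[R]_n) (K : nat) :
    'M[R]_n :=
  K%:R^-1 *: \sum_(1 <= k < K.+1) P ^+ k.

(* Main.v *)
(** Existence. If Z has independent standard normal coordinates, then w0 + A Z is
    Gaussian with mean w0 and covariance A A^T, and A = P_0 satisfies A A^T = A:
    from P P_0 = P_0 and P^T P = 1 one gets P_0^T P_0 = P_0^T, so P_0 is an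
    orthogonal projection. Z is built on iterated product spaces, and its linear
    functionals are normal because a convolution of normal laws is normal.

    Equivalence. Let s be the permutation of P. If P W = W a.s., then W_i and
    W_(s i) have the same mean, so P w0 = w0. Conversely, if P w0 = w0, then
    P P_0 = P_0 makes the variance of W_i - W_(s i) vanish and its mean is 0,
    hence W_i = W_(s i) a.s. Only first and second moments are used here. *)
From HB Require Import structures.
Require Import Defs.
From mathcomp Require Import all_boot all_order fingroup perm all_algebra.
From mathcomp Require Import all_classical all_reals all_analysis.
From mathcomp Require Import measurable_realfun.
From mathcomp Require Import ring lra.

Set Implicit Arguments.
Unset Strict Implicit.
Unset Printing Implicit Defensive.

Import Order.TTheory GRing.Theory Num.Theory.
Import numFieldNormedType.Exports.

Local Open Scope classical_set_scope.
Local Open Scope ring_scope.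

(** * Base-[J] digits and the bijectivity of vectorization *)

Lemma digits_inj (J D a b : nat) : (a < J ^ D)%N -> (b < J ^ D)%N ->
  (forall k, (k < D)%N -> (a %/ J ^ k) %% J = (b %/ J ^ k) %% J)%N -> a = b.
Proof.
elim: D a b => [|D IH] a b; first by rewrite expn0 !ltnS !leqn0 => /eqP-> /eqP->.
case: (posnP J) => [->|J0]; first by rewrite exp0n.
rewrite expnS => aJ bJ ab.
have h0 := ab 0%N isT; rewrite expn0 !divn1 in h0.
rewrite (divn_eq a J) (divn_eq b J) h0; congr (_ * J + _)%N.
(* The lowest digits agree; dividing by [J] shifts the remaining digits down by one place, where
   induction applies. *)
apply: IH; rewrite ?ltn_divLR// 1?mulnC// => k kD.
by rewrite -!divnMA -expnS; exact: ab.
Qed.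

Lemma multi_index_inj (J D : nat) : injective (@multi_index J D).
Proof.
move=> i j /ffunP ij; apply/val_inj/(digits_inj (ltn_ord i) (ltn_ord j)) => k kD.
by have /(congr1 val) := ij (Ordinal kD); rewrite !ffunE.
Qed.

(** This turns a Gaussian random vector into a random tensor at the end of the existence proof. *)
Lemma vec_surj (R : realType) (J D : nat) (x : 'cV[R]_(J ^ D)) :
  exists W : tensor R J D, vec W = x.
Proof.
(* By injectivity of [multi_index], the index picked at [multi_index i] is [i] itself; 0 is a
   default outside the image. *)
exists [ffun m => if [pick i | multi_index i == m] is Some i then x i 0 else 0].
apply/colP => i; rewrite mxE ffunE; case: pickP => [j /eqP/multi_index_inj->//|].
by move/(_ i); rewrite eqxx.
Qed.

(** * The averaged powers of a permutation matrix as an orthogonal projection *)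

Section power_mean.
Context {R : realType} (n K : nat) (P : 'M[R]_n).
Hypotheses (K0 : (0 < K)%N) (PK : P ^+ K = 1%:M).
Local Notation A := (power_mean P K).

(** Multiplication by [P] shifts the exponents to 2, ..., K+1, and [P ^+ K.+1 = P] closes the
    cycle. *)
Lemma mul_power_mean : P *m A = A.
Proof.
rewrite /power_mean -scalemxAr mulmx_sumr; congr (_ *: _).
under eq_bigr do rewrite -[P *m _]exprS.
rewrite -(big_add1 _ _ 1 K.+2 xpredT (GRing.exp P)) big_nat_recr//=.
by rewrite [RHS]big_ltn// expr1 exprS PK [P * _]mulmx1 addrC.
Qed.

(** Since [P] is orthogonal, transposing [P *m A = A] shows that [A^T] absorbs [P] on its right,
    hence every power of [P]; averaging K copies of [A^T] returns [A^T]. *)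
Lemma tr_mul_power_mean : is_perm_mx P -> A^T *m A = A^T.
Proof.
case/is_perm_mxP => s Ps.
have PTP : P^T *m P = 1%:M.
  by rewrite Ps tr_perm_mx -perm_mxM mulVg perm_mx1.
have AP : A^T *m P = A^T.
  by rewrite -{1}mul_power_mean trmx_mul -mulmxA PTP mulmx1.
have AX k : A^T *m P ^+ k = A^T.
  elim: k => [|k IH]; first by rewrite expr0 mulmx1.
  by rewrite exprS [_ * _]/(_ *m _) mulmxA AP IH.
rewrite {2}/power_mean -scalemxAr mulmx_sumr.
under eq_bigr do rewrite AX.
rewrite sumr_const_nat subSS subn0 -[A^T *+ _]scaler_nat scalerA mulVf ?scale1r//.
by rewrite pnatr_eq0 -lt0n.
Qed.

(** The product [A^T *m A] is symmetric and equals [A^T]. *)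
Lemma tr_power_mean : is_perm_mx P -> A^T = A.
Proof.
move=> hP; have AA := tr_mul_power_mean hP.
by rewrite -[RHS]trmxK -AA trmx_mul trmxK.
Qed.

Lemma mul_tr_power_mean : is_perm_mx P -> A *m A^T = A.
Proof.
move=> hP; have AT := tr_power_mean hP.
by rewrite AT -{1}AT tr_mul_power_mean.
Qed.

End power_mean.

(** * Square-integrable variables and vanishing variance *)

Section square_integrable.
Context d (T : measurableType d) (R : realType) (Pr : probability T R).
Implicit Types X Y : T -> R.

Lemma Lfun2_integrable_sqrP X : X \in Lfun Pr 2%:E <->
  measurable_fun [set: T] X /\ Pr.-integrable [set: T] (EFin \o (fun t => X t ^+ 2)).
Proof.
split=> [X2|[mX iX]].
  split; last exact: Lfun2_integrable_sqr.
  exact: set_mem (sub_Lfun_mfun X2).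
rewrite inE; apply/andP; split; rewrite inE//= /finite_norm unlock /Lnorm.
rewrite poweR_lty//.
case/integrableP: iX => _; apply: le_lt_trans; rewrite le_eqVlt; apply/orP; left.
apply/eqP; apply: eq_integral => t _ /=.
by rewrite normrX powR_mulrn.
Qed.

(** The variance integrates the nonnegative function [(X - m)^2]; a zero integral forces it to
    vanish almost everywhere. *)
Lemma variance_eq0_ae X : X \in Lfun Pr 2%:E -> ('V_Pr[X] = 0)%E ->
  {ae Pr, forall t, X t = fine 'E_Pr[X]}.
Proof.
move=> X2; rewrite /variance unlock => V0.
have mX : measurable_fun [set: T] X by case/Lfun2_integrable_sqrP : X2.
set m := fine 'E_Pr[X] in V0 *; rewrite unlock in V0.
pose D t : \bar R := ((X t - m) * (X t - m))%:E.
have mD : measurable_fun [set: T] D.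
  by apply/measurable_EFinP; apply: measurable_funM; exact: measurable_funB.
have [+ _] := ae_eq_integral_abs Pr measurableT mD.
have -> : (\int[Pr]_x `|D x|)%E = 0%E.
  rewrite -[RHS]V0; apply: eq_integral => t _ /=.
  by rewrite ger0_norm//; exact: sqr_ge0.
move=> /(_ erefl); apply: filterS => t /(_ I) /= [] /eqP.
by rewrite mulf_eq0 orbb subr_eq0 => /eqP.
Qed.

(** A zero variance would concentrate all the mass on one fibre of [X], but every fibre is null. *)
Lemma variance_gt0 X : X \in Lfun Pr 2%:E ->
  (forall c, Pr (X @^-1` [set c]) = 0%E) -> (0 < 'V_Pr[X])%E.
Proof.
move=> X2 X0; have mX : measurable_fun [set: T] X by case/Lfun2_integrable_sqrP : X2.
rewrite lt_neqAle variance_ge0 andbT eq_sym; apply/eqP => V0.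
have [A [mA A0 sA]] := variance_eq0_ae X2 V0.
set m := fine _ in sA.
have mXm : measurable (X @^-1` [set m]).
  by rewrite -[X in measurable X]setTI; exact: mX.
have : (Pr [set: T] <= 0)%E.
  rewrite -(setUv (X @^-1` [set m])).
  apply: (le_trans (measureU2 _ _ _)) => //; first exact: measurableC.
  rewrite -(X0 m) -[leRHS]adde0 leeD// -A0 le_measure ?inE//.
  exact: measurableC.
by rewrite probability_setT lee_fin ler10.
Qed.

End square_integrable.

(** * Transfer of moments along measure-preserving maps *)

Section measure_preserving.
Context d d' (T : measurableType d) (T' : measurableType d') (R : realType).
Variables (Pr : probability T R) (Q : probability T' R) (phi : T -> T').
Hypotheses (mphi : measurable_fun [set: T] phi)
  (phiQ : forall A, measurable A -> Pr (phi @^-1` A) = Q A).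

Lemma integral_measure_preserving (f : T' -> \bar R) : measurable_fun [set: T'] f ->
  (\int[Pr]_x f (phi x) = \int[Q]_y f y)%E.
Proof.
move=> mf.
have ge0 (g : T' -> \bar R) : measurable_fun [set: T'] g ->
    (forall y, 0 <= g y)%E -> (\int[Pr]_x g (phi x) = \int[Q]_y g y)%E.
  move=> mg g0.
  pose psi : {mfun T >-> T'} := HB.pack phi (isMeasurableFun.Build _ _ _ _ _ mphi).
  transitivity (\int[pushforward Pr psi]_y g y)%E.
    by rewrite (ge0_integral_pushforward mphi)// preimage_setT.
  by apply: eq_measure_integral => A mA _; exact: phiQ.
rewrite integralE [RHS]integralE; congr (_ - _)%E; rewrite -ge0//.
- by apply: eq_integral => x _; rewrite !funeposE.
- exact: measurable_funepos.
- by apply: eq_integral => x _; rewrite !funenegE.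
- exact: measurable_funeneg.
Qed.

Lemma expectation_measure_preserving (X : T' -> R) : measurable_fun [set: T'] X ->
  'E_Pr[X \o phi]%E = 'E_Q[X]%E.
Proof.
by move=> mX; rewrite unlock -integral_measure_preserving//; exact/measurable_EFinP.
Qed.

Lemma covariance_measure_preserving (X Y : T' -> R) :
  measurable_fun [set: T'] X -> measurable_fun [set: T'] Y ->
  covariance Pr (X \o phi) (Y \o phi) = covariance Q X Y.
Proof.
move=> mX mY; rewrite unlock !expectation_measure_preserving//.
rewrite -[RHS]expectation_measure_preserving//.
by apply: measurable_funM; exact: measurable_funB.
Qed.

Lemma Lfun2_measure_preserving (X : T' -> R) : X \in Lfun Q 2%:E ->
  X \o phi \in Lfun Pr 2%:E.
Proof.
move/Lfun2_integrable_sqrP => [mX iX]; apply/Lfun2_integrable_sqrP; split.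
  exact: measurableT_comp.
case/integrableP : iX => mX2 iX; apply/integrableP; split.
  by apply/measurable_EFinP/measurable_funX; exact: measurableT_comp.
move: iX; rewrite -integral_measure_preserving//.
exact: measurableT_comp.
Qed.

End measure_preserving.

(** * Product probabilities and independence of the two factors *)

Section product_probability.
Context d d' (T : measurableType d) (T' : measurableType d') (R : realType).
Variables (P1 : probability T R) (P2 : probability T' R).

Let prodT : (P1 \x P2)%E [set: T * T'] = 1%E.
Proof.
rewrite -setXTT product_measure1E//.
by rewrite -[RHS]mule1; congr (_ * _)%E; exact: probability_setT.
Qed.

HB.instance Definition _ := Measure_isProbability.Build _ _ _ (P1 \x P2)%E prodT.

Lemma product_measure1_fst A : measurable A -> (P1 \x P2)%E (fst @^-1` A) = P1 A.
Proof.
move=> mA; rewrite -[RHS]mule1 -(probability_setT P2) -product_measure1E//.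
by rewrite setXT.
Qed.

Lemma product_measure1_snd A : measurable A -> (P1 \x P2)%E (snd @^-1` A) = P2 A.
Proof.
move=> mA; rewrite -[RHS]mul1e -(probability_setT P1) -product_measure1E//.
by rewrite setTX.
Qed.

(** By Fubini, the expectation of the product factors into the product of the expectations. *)
Lemma covariance_fst_snd (X : T -> R) (Y : T' -> R) :
  X \in Lfun P1 2%:E -> Y \in Lfun P2 2%:E ->
  covariance (P1 \x P2)%E (X \o fst) (Y \o snd) = 0%E.
Proof.
move=> X2 Y2.
have mX : measurable_fun [set: T] X by case/Lfun2_integrable_sqrP : X2.
have mY : measurable_fun [set: T'] Y by case/Lfun2_integrable_sqrP : Y2.
have fX2 : (X \o fst : T * T' -> R) \in Lfun (P1 \x P2)%E 2%:E.
  apply: (Lfun2_measure_preserving _ _ X2) => //; exact: product_measure1_fst.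
have sY2 : (Y \o snd : T * T' -> R) \in Lfun (P1 \x P2)%E 2%:E.
  apply: (Lfun2_measure_preserving _ _ Y2) => //; exact: product_measure1_snd.
have fin1 := fin_num_measure P1 _ measurableT.
have fin2 := fin_num_measure P2 _ measurableT.
have fin12 : (P1 \x P2)%E [set: T * T'] \is a fin_num by rewrite prodT.
have XY1 := Lfun2_mul_Lfun1 fX2 sY2.
rewrite (covarianceE (Lfun_subset12 fin12 fX2) (Lfun_subset12 fin12 sY2) XY1).
rewrite (expectation_measure_preserving _ product_measure1_fst)//.
rewrite (expectation_measure_preserving _ product_measure1_snd)//.
have EY : 'E_P2[Y]%E \is a fin_num by rewrite expectation_fin_num// Lfun_subset12.
have EX : 'E_P1[X]%E \is a fin_num by rewrite expectation_fin_num// Lfun_subset12.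
rewrite [X in (X - _)%E](_ : _ = 'E_P1[X] * 'E_P2[Y])%E ?subee ?fin_numM//.
rewrite [in LHS]unlock -integral12_prod_meas1; last exact/Lfun1_integrable.
transitivity (\int[P1]_x ((X x)%:E * (fine 'E_P2[Y])%:E))%E.
  apply: eq_integral => x _; rewrite /fubini_F fineK//.
  rewrite (_ : 'E_P2[Y]%E = \int[P2]_y (Y y)%:E)%E ?unlock//.
  by rewrite -integralZl//; exact/Lfun1_integrable/Lfun_subset12.
rewrite integralZr//; last exact/Lfun1_integrable/Lfun_subset12.
by rewrite fineK//; congr (_ * _)%E; rewrite unlock.
Qed.

End product_probability.

(** * Lebesgue measure under affine maps *)

Section affine_change_of_variables.
Context {R : realType}.
Local Notation mu := (@lebesgue_measure R).

Lemma measurable_affine_preimage (c b : R) (A : set R) :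
  measurable A -> measurable ((fun x => c * x + b) @^-1` A).
Proof.
move=> mA; rewrite -[X in measurable X]setTI.
suff : measurable_fun [set: R] (fun x : R => c * x + b) by exact.
by apply: measurable_funD => //; exact: measurable_funM.
Qed.

(** The pushforward scaled by [|c|] gives half-open intervals their length, and Lebesgue measure is
    the unique measure doing so. *)
Lemma lebesgue_measure_affine (c b : R) (A : set R) : c != 0 -> measurable A ->
  (mu A = `|c|%:E * mu ((fun x => c * x + b)%R @^-1` A))%E.
Proof.
move=> c0 mA.
pose phi (x : measurableTypeR R) : measurableTypeR R := c * x + b.
have mphi : measurable_fun [set: measurableTypeR R] phi.
  by apply: measurable_funD => //; exact: measurable_funM.
(* As a measure, [pushforward mu phi] takes a proof that [phi] is measurable,
   hence [nu mphi] below. *)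
pose nu := mscale (NngNum (normr_ge0 c)) (pushforward mu phi).
suff -> : mu A = nu mphi A by [].
apply: lebesgue_measure_unique => // _ [[l r]] _ <-.
transitivity (`|c|%:E * mu (phi @^-1` `]l, r]%classic))%E => //.
have [cgt|clt] : 0 < c \/ c < 0 by apply/orP; rewrite orbC -neq_lt.
- rewrite (_ : phi @^-1` _ = `](l - b) / c, (r - b) / c]%classic); last first.
    apply/seteqP; split => x /=; rewrite !in_itv/=.
      by rewrite ltr_pdivrMr// ler_pdivlMr// ltrBlDr lerBrDr mulrC.
    by rewrite ltr_pdivrMr// ler_pdivlMr// ltrBlDr lerBrDr mulrC.
  rewrite !lebesgue_measure_itv/= !lte_fin ltr_pM2r ?invr_gt0// ltrD2r.
  case: ifPn => _; last by rewrite mule0.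
  by rewrite gtr0_norm// -!EFinD -EFinM; congr EFin; field.
(* A negative slope reverses the order, so the preimage is closed on the left instead; its length is
   unaffected. *)
- rewrite (_ : phi @^-1` _ = `[(r - b) / c, (l - b) / c[%classic); last first.
    apply/seteqP; split => x /=; rewrite !in_itv/=.
      by rewrite ler_ndivrMr// ltr_ndivlMr// ltrBlDr lerBrDr mulrC andbC.
    by rewrite ler_ndivrMr// ltr_ndivlMr// ltrBlDr lerBrDr mulrC andbC.
  rewrite !lebesgue_measure_itv/= !lte_fin ltr_nM2r ?invr_lt0// ltrD2r.
  case: ifPn => _; last by rewrite mule0.
  by rewrite ltr0_norm// -!EFinD -EFinM; congr EFin; field.
Qed.

Lemma ge0_integral_affine (c b : R) (f : R -> \bar R) : c != 0 ->
  measurable_fun [set: R] f -> (forall x, 0 <= f x)%E ->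
  (\int[mu]_x f x = `|c|%:E * \int[mu]_x f (c * x + b)%R)%E.
Proof.
move=> c0 mf f0.
pose phi (x : measurableTypeR R) : measurableTypeR R := c * x + b.
have mphi : measurable_fun [set: measurableTypeR R] phi.
  by apply: measurable_funD => //; exact: measurable_funM.
pose nu := mscale (NngNum (normr_ge0 c)) (pushforward mu phi).
transitivity (\int[nu mphi]_x f x)%E.
  by apply: eq_measure_integral => A mA _; exact: lebesgue_measure_affine.
rewrite ge0_integral_mscale//; congr (_ * _)%E.
by rewrite (ge0_integral_pushforward mphi)// preimage_setT.
Qed.

End affine_change_of_variables.

(** * Normal laws on the real line: densities and affine images *)

Section normal.
Context {R : realType}.
Implicit Types a b c s t : R.
Local Notation mu := (@lebesgue_measure R).

Lemma normal_pdf_peak_fun a s x : s != 0 ->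
  normal_pdf a s x = normal_peak s * normal_fun a s x.
Proof. by move=> s0; rewrite normal_pdfE. Qed.

Lemma normal_pdf_affine a s c b x : c != 0 -> s != 0 ->
  normal_pdf a s x = `|c| * normal_pdf (c * a + b) (c * s) (c * x + b).
Proof.
move=> c0 s0; have cs0 : c * s != 0 by rewrite mulf_neq0.
rewrite !normal_pdfE// mulrA; congr (_ * _).
  rewrite /normal_peak.
  have -> : (c * s) ^+ 2 * pi *+ 2 = c ^+ 2 * (s ^+ 2 * pi *+ 2) by ring.
  rewrite sqrtrM ?sqr_ge0//.
  by rewrite sqrtr_sqr invfM mulrA mulfV ?mul1r// normr_eq0.
rewrite /normal_fun; congr expR; field.
by rewrite c0 s0.
Qed.

Lemma normal_prob_indic a s A :
  normal_prob a s A = (\int[mu]_x (normal_pdf a s x * \1_A x)%:E)%E.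
Proof.
rewrite /normal_prob integral_mkcond; apply: eq_integral => x _.
by rewrite patchE indicE; case: ifPn => _; rewrite ?mulr1 ?mulr0.
Qed.

Lemma measurable_normal_pdf_indic a s A : measurable A ->
  measurable_fun [set: R] (fun x => (normal_pdf a s x * \1_A x)%:E).
Proof.
move=> mA; apply/measurable_EFinP; apply: measurable_funM => //.
exact: measurable_normal_pdf.
Qed.

Lemma normal_prob_affine a s c b A : c != 0 -> s != 0 -> measurable A ->
  normal_prob a s ((fun x => c * x + b) @^-1` A) =
  normal_prob (c * a + b) (c * s) A.
Proof.
move=> c0 s0 mA; rewrite !normal_prob_indic [RHS](@ge0_integral_affine _ c b)//.
- rewrite -ge0_integralZl//.
  + apply: eq_integral => x _.
    by rewrite (@normal_pdf_affine a s c b)// -EFinM mulrA.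
  + apply: (measurableT_comp (measurable_normal_pdf_indic _ _ mA)).
    by apply: measurable_funD => //; exact: measurable_funM.
  + by move=> x _; rewrite lee_fin mulr_ge0// normal_pdf_ge0.
- exact: measurable_normal_pdf_indic.
- by move=> x; rewrite lee_fin mulr_ge0// normal_pdf_ge0.
Qed.

(* Completing the square in [y]. *)
Lemma normal_pdf_mul a s b t x y : s != 0 -> t != 0 ->
  let r := Num.sqrt (s ^+ 2 + t ^+ 2) in
  normal_pdf a s y * normal_pdf (y + b) t x =
  normal_pdf (a + b) r x *
  normal_pdf (((x - b) * s ^+ 2 + a * t ^+ 2) / r ^+ 2) (s * t / r) y.
Proof.
move=> s0 t0 r.
have r2 : r ^+ 2 = s ^+ 2 + t ^+ 2 by rewrite sqr_sqrtr// addr_ge0// sqr_ge0.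
have rr : s ^+ 2 + t ^+ 2 != 0.
  by rewrite gt_eqF// ltr_wpDr ?sqr_ge0// exprn_even_gt0.
have r0 : r != 0 by rewrite -sqrf_eq0 r2.
rewrite !normal_pdf_peak_fun ?mulf_neq0 ?invr_eq0//.
rewrite mulrACA [RHS]mulrACA; congr (_ * _).
  rewrite /normal_peak -!invfM -!sqrtrM ?mulrn_wge0 ?(mulr_ge0 (sqr_ge0 _) (pi_ge0 _))//.
  by congr (Num.sqrt _)^-1; field.
rewrite /normal_fun -!expRD; congr expR; rewrite expr_div_n r2.
by field; rewrite rr s0 t0.
Qed.

(** The Radon-Nikodym derivative of the normal law and [normal_pdf] have equal integrals over every
    measurable set, so they agree almost everywhere. *)
Lemma integral_normal_prob a s (f : R -> \bar R) :
  measurable_fun [set: R] f -> (forall x, 0 <= f x)%E ->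
  (\int[normal_prob a s]_x f x = \int[mu]_x (f x * (normal_pdf a s x)%:E))%E.
Proof.
move=> mf f0.
have dom := normal_prob_dominates a s.
rewrite -(Radon_Nikodym_SigmaFinite.change_of_variables dom)//.
apply: ae_eq_integral => //.
- apply: emeasurable_funM => //; apply: measurable_int.
  exact: Radon_Nikodym_SigmaFinite.f_integrable.
- apply: emeasurable_funM => //; apply/measurable_EFinP.
  exact: measurable_normal_pdf.
- apply: ae_eqe_mul2l; apply: integral_ae_eq => //.
  + exact: Radon_Nikodym_SigmaFinite.f_integrable.
  + by apply/measurable_EFinP; exact: measurable_normal_pdf.
  + by move=> E _ mE; rewrite -Radon_Nikodym_SigmaFinite.f_integral.
Qed.

Lemma normal_pdf_addl a b s x : s != 0 ->
  normal_pdf (a + b) s x = normal_pdf b s (x - a).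
Proof. by move=> s0; rewrite !normal_pdfE// /normal_fun opprD addrA. Qed.

(** * Sums of independent normal variables *)

Section convolution.
Variables (a s b t : R) (A : set R).
Hypotheses (s0 : s != 0) (t0 : t != 0) (mA : measurable A).

(** Conditional density of the sum, cut down to [A], given the value [p.1] of the first summand. *)
Let joint (p : R * R) : \bar R := (normal_pdf (p.1 + b) t p.2 * \1_A p.2)%:E.

Let joint_ge0 p : (0 <= joint p)%E.
Proof. by rewrite lee_fin mulr_ge0// normal_pdf_ge0. Qed.

Let measurable_joint : measurable_fun [set: R * R] joint.
Proof.
apply/measurable_EFinP; apply: measurable_funM; last first.
  by apply: (measurableT_comp (measurable_indic mA)); exact: measurable_snd.
(* Moving [p.1] from the mean to the argument exhibits a fixed density composed with the measurable
   map [p.2 - p.1]. *)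
under eq_fun do rewrite normal_pdf_addl//.
apply: (measurableT_comp (measurable_normal_pdf _ _)).
by apply: measurable_funB; [exact: measurable_snd|exact: measurable_fst].
Qed.

Lemma measurable_normal_prob_mean :
  measurable_fun [set: R] (fun y => normal_prob (y + b) t A).
Proof.
under eq_fun do rewrite normal_prob_indic.
exact: (@measurable_fun_fubini_tonelli_F _ _ _ _ _ mu joint).
Qed.

(** After Tonelli, [normal_pdf_mul] splits the integrand into the density of the sum at [x] and a
    normal density in [y], which integrates to 1. *)
Lemma normal_prob_convolution :
  (\int[normal_prob a s]_y normal_prob (y + b) t A =
   normal_prob (a + b) (Num.sqrt (s ^+ 2 + t ^+ 2)) A)%E.
Proof.
rewrite integral_normal_prob//; last exact: measurable_normal_prob_mean.
rewrite [RHS]normal_prob_indic.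
pose f (p : R * R) := (joint p * (normal_pdf a s p.1)%:E)%E.
have mf : measurable_fun [set: R * R] f.
  apply: emeasurable_funM; first exact: measurable_joint.
  apply/measurable_EFinP/(measurableT_comp (measurable_normal_pdf _ _)).
  exact: measurable_fst.
have f0 p : (0 <= f p)%E by rewrite mule_ge0// lee_fin normal_pdf_ge0.
transitivity (\int[mu]_y \int[mu]_x f (y, x))%E.
  apply: eq_integral => y _; rewrite normal_prob_indic -ge0_integralZr//.
  - exact: measurable_normal_pdf_indic.
  - by move=> x _; exact: (joint_ge0 (y, x)).
  - by rewrite lee_fin normal_pdf_ge0.
rewrite fubini_tonelli//; apply: eq_integral => x _.
under eq_integral => y _.
  rewrite /f /joint/= -EFinM mulrAC [X in X * _]mulrC normal_pdf_mul// mulrAC EFinM.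
  over.
rewrite integralZl//; last exact: integrable_normal_pdf.
by rewrite integral_normal_pdf mule1.
Qed.

End convolution.

(** * Normal laws with possibly zero scale, and the second moment *)

Lemma normal_law0 a : normal_law a 0 = dirac a.
Proof. by rewrite /normal_law eqxx. Qed.

Lemma normal_lawE a s : s != 0 -> normal_law a s = normal_prob a s.
Proof. by rewrite /normal_law => /negbTE->. Qed.

(** The point mass at scale 0 covers the degenerate cases: a point mass moves to its image, and for
    [c = 0] the preimage is everything or empty. *)
Lemma normal_law_affine a s c b A : measurable A ->
  normal_law a s ((fun x => c * x + b) @^-1` A) = normal_law (c * a + b) (c * s) A.
Proof.
move=> mA; have [->|s0] := eqVneq s 0.
  by rewrite mulr0 !normal_law0 /dirac !indicE; congr (_%:R)%:E; apply/idP/idP; rewrite !inE.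
have [->|c0] := eqVneq c 0.
  rewrite !mul0r add0r normal_law0 normal_lawE// /dirac indicE.
  have -> : (fun x => 0 * x + b) @^-1` A = if b \in A then setT else set0.
    by case: ifPn => bA; apply/seteqP; split => x//=; rewrite mul0r add0r;
      [rewrite inE in bA|move/mem_set; rewrite (negbTE bA)].
  by case: ifPn => _; [exact: probability_setT|rewrite measure0].
by rewrite !normal_lawE ?mulf_neq0// normal_prob_affine.
Qed.

Lemma measurable_normal_law_mean b t A : measurable A ->
  measurable_fun [set: R] (fun y => normal_law (y + b) t A).
Proof.
move=> mA; have [->|t0] := eqVneq t 0.
  under eq_fun do rewrite normal_law0 /dirac.
  apply/measurable_EFinP; apply: (measurableT_comp (measurable_indic mA)).
  exact: measurable_funD.
under eq_fun do rewrite normal_lawE//.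
exact: measurable_normal_prob_mean.
Qed.

(** The integral is the law of the sum of [X] and an independent normal variable. The scale [r] is
    [t] when [s = 0], [s] when [t = 0], and otherwise comes from completing the square. *)
Lemma normal_law_convolution d (T : measurableType d) (Pr : probability T R)
    (X : T -> R) a s b t : measurable_fun [set: T] X ->
    (forall A, measurable A -> Pr (X @^-1` A) = normal_law a s A) ->
  exists r, forall A, measurable A ->
    (\int[Pr]_w normal_law (X w + b) t A)%E = normal_law (a + b) r A.
Proof.
move=> mX; have [->|s0] := eqVneq s 0; [rewrite normal_law0|rewrite normal_lawE//] => XPr.
  exists t => A mA; have mf := measurable_normal_law_mean b t mA.
  by rewrite (integral_measure_preserving mX XPr mf) integral_dirac// diracT mul1e.
have [->|t0] := eqVneq t 0.
  exists s => A mA; have mf := measurable_normal_law_mean b 0 mA.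
  rewrite (@integral_measure_preserving _ _ _ _ _ Pr (normal_prob a s) X mX XPr _ mf).
  (* Adding [b] is the affine map of slope 1, hence the factors 1. *)
  rewrite -[in RHS](mul1r a) -[in RHS](mul1r s) -normal_law_affine// normal_lawE//.
  under eq_integral do rewrite normal_law0 /dirac.
  have := measurable_affine_preimage 1 b mA.
  rewrite (_ : (fun x => 1 * x + b) @^-1` A = (fun x => x + b) @^-1` A) => [mB|].
    by rewrite -[X in normal_prob _ _ X]setIT -integral_indic.
  by apply/funext => x /=; rewrite mul1r.
exists (Num.sqrt (s ^+ 2 + t ^+ 2)) => A mA; have mf := measurable_normal_law_mean b t mA.
rewrite (@integral_measure_preserving _ _ _ _ _ Pr (normal_prob a s) X mX XPr _ mf).
under eq_integral do rewrite normal_lawE//.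
rewrite normal_prob_convolution// normal_lawE//.
by rewrite gt_eqF// sqrtr_gt0 ltr_wpDr ?sqr_ge0// exprn_even_gt0.
Qed.

(** The square times the density of scale 1 is dominated by a multiple of the density of scale 2,
    which is integrable. *)
Lemma Lfun2_normal_prob : (id : measurableTypeR R -> R) \in Lfun (@normal_prob R 0 1) 2%:E.
Proof.
apply/Lfun2_integrable_sqrP; split; first exact: measurable_id.
have mid2 : measurable_fun [set: R] (fun x : R => (x ^+ 2)%:E).
  by apply/measurable_EFinP; exact: measurable_funX.
apply/integrableP; split; first exact: mid2.
apply: (@le_lt_trans _ _ (\int[@normal_prob R 0 1]_x (x ^+ 2)%:E)%E).
  rewrite le_eqVlt; apply/orP; left; apply/eqP; apply: eq_integral => x _ /=.
  by rewrite ger0_norm// sqr_ge0.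
rewrite integral_normal_prob//; last by move=> x; rewrite lee_fin sqr_ge0.
(* The exponents [- x^2/2] and [- x^2/8] differ by [3/8 * x^2], and [expR y >= y] gives
   [x^2 <= 8/3 * expR (3/8 * x^2)]; the ratio of peaks adjusts the normalizations. *)
pose C : R := 8 / 3 * (normal_peak 1 / normal_peak 2).
apply: (@le_lt_trans _ _ (\int[mu]_x (C%:E * (normal_pdf 0 2 x)%:E))%E).
  apply: ge0_le_integral => //.
  - by move=> x _; rewrite -EFinM lee_fin mulr_ge0 ?sqr_ge0 ?normal_pdf_ge0.
  - apply: emeasurable_funM => //; apply/measurable_EFinP.
    exact: measurable_normal_pdf.
  - apply: emeasurable_funM => //; apply/measurable_EFinP.
    exact: measurable_normal_pdf.
  - move=> x _; rewrite -!EFinM lee_fin !normal_pdf_peak_fun//.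
    have p2 : @normal_peak R 2 != 0 by rewrite gt_eqF// normal_peak_gt0.
    rewrite (_ : C * _ = normal_peak 1 * (8 / 3 * normal_fun 0 2 x)); last first.
      by rewrite /C; field.
    rewrite mulrCA ler_wpM2l ?normal_peak_ge0//.
    have -> : normal_fun 0 2 x = expR (3 / 8 * x ^+ 2) * normal_fun 0 1 x.
      by rewrite /normal_fun -expRD; congr expR; field.
    rewrite mulrA ler_wpM2r ?normal_fun_ge0// mulrC -ler_pdivrMr//.
    by apply: le_trans (expR_ge1Dx _); lra.
rewrite integralZl//; last exact: integrable_normal_pdf.
by rewrite integral_normal_pdf mule1 ltry.
Qed.

End normal.

(** * Expectation of finite linear combinations *)

Section expectation.
Context d (T : measurableType d) (R : realType) (Pr : probability T R).

Lemma Lfun1_lincomb (I : finType) (c : I -> R) (f : I -> T -> R) :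
  (forall i, f i \in Lfun Pr 1) -> (fun t => \sum_i c i * f i t) \in Lfun Pr 1.
Proof.
move=> f1; apply/Lfun1_integrable; rewrite /comp.
under eq_fun do rewrite -sumEFin.
apply: integrable_sum => // i _; under eq_fun do rewrite EFinM.
by apply: integrableZl => //; exact/Lfun1_integrable.
Qed.

Lemma expectation_lincomb (I : finType) (c : I -> R) (f : I -> T -> R) :
  (forall i, f i \in Lfun Pr 1) ->
  'E_Pr[(fun t => \sum_i c i * f i t)%R]%E = (\sum_i c i * fine 'E_Pr[f i]%E)%:E.
Proof.
move=> f1; rewrite [in LHS]unlock.
under eq_integral do rewrite -sumEFin.
rewrite integral_sum//; last first.
  move=> i; under eq_fun do rewrite EFinM.
  by apply: integrableZl => //; exact/Lfun1_integrable.
rewrite -sumEFin; apply: eq_bigr => i _.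
under eq_integral do rewrite EFinM.
rewrite integralZl//; last exact/Lfun1_integrable.
rewrite EFinM fineK ?expectation_fin_num//.
by rewrite unlock.
Qed.

End expectation.

(** * Moments and affine images of Gaussian vectors *)

Section gaussian.
Context d (T : measurableType d) (R : realType) (Pr : probability T R) (n : nat).
Variables (X : T -> 'cV[R]_n) (m : 'cV[R]_n) (S : 'M[R]_n).
Hypothesis gX : gaussian_vector Pr X m S.

Lemma gaussian_measurable i : measurable_fun [set: T] (fun t => X t i 0).
Proof. by case: gX. Qed.

Let Z i t := X t i 0 - m i 0.

Let EZZ i j : 'E_Pr[(fun t => Z i t * Z j t)%R]%E = (S i j)%:E.
Proof.
case: gX => _ _ E <-; rewrite [in RHS]unlock !E; by congr expectation.
Qed.

(** The covariance clause makes the second moment of the centred coordinate [Z i] equal to [S i i],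
    hence finite; the mean is then added back. *)
Lemma gaussian_Lfun2 i : (fun t => X t i 0) \in Lfun Pr 2%:E.
Proof.
have mX := gaussian_measurable i.
have Z2 : Z i \in Lfun Pr 2%:E.
  have mZ : measurable_fun [set: T] (Z i) by exact: measurable_funB.
  apply/Lfun2_integrable_sqrP; split=> //; apply/integrableP; split.
    by apply/measurable_EFinP/measurable_funX.
  have := EZZ i i; rewrite unlock => EZ.
  rewrite (@eq_integral _ _ _ _ _ (fun t => (Z i t * Z i t)%:E)) ?EZ ?ltry//.
  by move=> t _ /=; rewrite ger0_norm ?sqr_ge0// expr2.
rewrite (_ : (fun _ => _) = Z i \+ cst (m i 0)).
  by rewrite rpredD ?lee1n//= => _; rewrite Lfun_cst.
by apply/funext => t /=; rewrite /Z subrK.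
Qed.

Lemma gaussian_measurable_lincomb (u : 'cV[R]_n) :
  measurable_fun [set: T] (fun t => (u^T *m X t) 0 0).
Proof.
under eq_fun do rewrite mxE.
apply: measurable_sum => k; apply: measurable_funM => //.
exact: gaussian_measurable.
Qed.

(** A functional [u] of the image is the functional [B^T *m u] of [X] plus a constant, so it stays
    normal; the covariance follows by bilinearity. *)
Lemma gaussian_affine p (B : 'M[R]_(p, n)) (b : 'cV[R]_p) :
  gaussian_vector Pr (fun t => B *m X t + b) (B *m m + b) (B *m S *m B^T).
Proof.
have Pfin : Pr [set: T] \is a fin_num := fin_num_measure Pr _ measurableT.
have X1 i := Lfun_subset12 Pfin (gaussian_Lfun2 i).
have Z2 i : Z i \in Lfun Pr 2%:E.
  rewrite (_ : Z i = (fun t => X t i 0) \+ cst (- m i 0))//.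
  have X2 := gaussian_Lfun2 i.
  by rewrite rpredD ?lee1n//= => _; rewrite Lfun_cst.
case: (gX) => mX lawX EX _.
have EY i : 'E_Pr[(fun t => (B *m X t + b) i 0)%R]%E = ((B *m m + b) i 0)%:E.
  rewrite (_ : (fun t => _) = (fun t => \sum_k B i k * X t k 0) \+ cst (b i 0)); last first.
    by apply/funext => t; rewrite !mxE.
  rewrite expectationD ?Lfun_cst ?Lfun1_lincomb//.
  rewrite expectation_cst expectation_lincomb// -EFinD !mxE; congr (_ + _)%:E.
  by apply: eq_bigr => k _; rewrite EX.
split => //.
- move=> i; rewrite (_ : (fun t => _) = (fun t => \sum_k B i k * X t k 0 + b i 0)).
    apply: measurable_funD => //; apply: measurable_sum => k.
    by apply: measurable_funM => //; exact: mX.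
  by apply/funext => t; rewrite !mxE.
- move=> u; have [a [s H]] := lawX (B^T *m u).
  exists (1 * a + (u^T *m b) 0 0), (1 * s) => A mA.
  rewrite -normal_law_affine// -H.
    congr (Pr _); apply/funext => t /=.
    by rewrite mulmxDr mulmxA trmx_mul trmxK mul1r !mxE.
  exact: measurable_affine_preimage.
- move=> i j; rewrite unlock !EY.
  (* Indexing the double sum by pairs makes it a single linear combination, so [expectation_lincomb]
     applies. *)
  transitivity ('E_Pr[(fun t => \sum_(q : 'I_n * 'I_n) (B i q.1 * B j q.2) *
      (Z q.1 t * Z q.2 t))%R])%E.
    have YE k t : (B *m X t + b) k 0 - (B *m m + b) k 0 = \sum_l B k l * Z l t.
      rewrite !mxE opprD addrACA subrr addr0 -sumrB.
      by apply: eq_bigr => l _; rewrite -mulrBr.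
    congr expectation; apply/funext => t.
    transitivity (((B *m X t + b) i 0 - (B *m m + b) i 0) *
                  ((B *m X t + b) j 0 - (B *m m + b) j 0)) => //.
    rewrite !YE big_distrlr pair_bigA/=; apply: eq_bigr => q _.
    by rewrite mulrACA.
  rewrite expectation_lincomb; last first.
    by move=> q; exact: (Lfun2_mul_Lfun1 (Z2 _) (Z2 _)).
  congr EFin; under eq_bigr do rewrite EZZ/=.
  rewrite -(pair_bigA _ (fun k l => B i k * B j l * S k l))/= exchange_big !mxE/=.
  apply: eq_bigr => l _; rewrite !mxE big_distrl/=; apply: eq_bigr => k _.
  by rewrite mulrAC.
Qed.

End gaussian.

(** * Stacking independent Gaussian vectors *)

Section gaussian_product.
Context d d' (T : measurableType d) (T' : measurableType d') (R : realType).
Variables (P1 : probability T R) (P2 : probability T' R) (n p : nat).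
Variables (X : T -> 'cV[R]_n) (m : 'cV[R]_n) (S : 'M[R]_n).
Variables (Y : T' -> 'cV[R]_p) (m' : 'cV[R]_p) (S' : 'M[R]_p).
Hypotheses (gX : gaussian_vector P1 X m S) (gY : gaussian_vector P2 Y m' S').

(** A functional of the stacked vector is a sum of two independent normal variables, normal by
    convolution; independence kills the off-diagonal covariance blocks. *)
Lemma gaussian_product : gaussian_vector (P1 \x P2)%E
  (fun w => col_mx (X w.1) (Y w.2)) (col_mx m m') (block_mx S 0 0 S').
Proof.
have X2 := gaussian_Lfun2 gX; have Y2 := gaussian_Lfun2 gY.
have Xl i : (fun w : T * T' => col_mx (X w.1) (Y w.2) (lshift p i) 0) =
    (fun t => X t i 0) \o fst by apply/funext => w; rewrite col_mxEu.
have Yr i : (fun w : T * T' => col_mx (X w.1) (Y w.2) (rshift n i) 0) =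
    (fun t => Y t i 0) \o snd by apply/funext => w; rewrite col_mxEd.
case: (gX) (gY) => mX lawX EX CX [mY lawY EY CY].
have fstP := product_measure1_fst P1 P2.
have sndP := product_measure1_snd P1 P2.
split.
- move=> i; case: (split_ordP i) => k ->; rewrite ?Xl ?Yr.
    by apply: measurableT_comp; [exact: mX|exact: measurable_fst].
  by apply: measurableT_comp; [exact: mY|exact: measurable_snd].
- move=> u; rewrite -(vsubmxK u).
  have [a [s Hs]] := lawX (usubmx u); have [b [t Ht]] := lawY (dsubmx u).
  have mU := gaussian_measurable_lincomb gX (usubmx u).
  have [r Hr] := normal_law_convolution b t mU Hs.
  exists (a + b), r => A mA; rewrite -Hr//.
  (* The product measure is by definition the integral of the measures of the sections; with the
     first point fixed, the section is an event about [Y] shifted by the constant [U]. *)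
  apply: eq_integral => w _ /=.
  set U := (_ *m X w) 0 0.
  have -> : U + b = 1 * b + U by rewrite mul1r addrC.
  rewrite -[t]mul1r -normal_law_affine// -?Ht//.
    have UE y : ((col_mx (usubmx u) (dsubmx u))^T *m col_mx (X w) (Y y)) 0 0 =
        1 * ((dsubmx u)^T *m Y y) 0 0 + U.
      by rewrite tr_col_mx mul_row_col mxE mul1r addrC.
    by congr (P2 _); apply/seteqP; split => y /=; rewrite /xsection/= inE/= UE.
  exact: measurable_affine_preimage.
- move=> i; case: (split_ordP i) => k ->; rewrite ?Xl ?Yr.
    by rewrite (expectation_measure_preserving _ fstP)// EX col_mxEu.
  by rewrite (expectation_measure_preserving _ sndP)// EY col_mxEd.
- move=> i j; case: (split_ordP i) => k ->; case: (split_ordP j) => l ->; rewrite ?Xl ?Yr.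
  + by rewrite block_mxEul (covariance_measure_preserving _ fstP).
  + by rewrite block_mxEur mxE covariance_fst_snd.
  + by rewrite block_mxEdl mxE covarianceC covariance_fst_snd.
  + by rewrite block_mxEdr (covariance_measure_preserving _ sndP).
Qed.

End gaussian_product.

(** * Standard Gaussian vectors in every dimension *)

Section standard.
Context (R : realType).
Local Notation N01 := (@normal_prob R 0 1).
Local Notation RT := (measurableTypeR R).

(** Being dominated by Lebesgue measure, the normal law has no atoms. *)
Lemma variance_normal_gt0 : (0 < 'V_N01[(id : RT -> R)])%E.
Proof.
apply: variance_gt0 => [|c]; first exact: Lfun2_normal_prob.
have /null_content_dominatesP dom := @normal_prob_dominates R 0 1.
by apply: dom; [exact: measurable_set1|exact: lebesgue_measure_set1].
Qed.

(* Standardising [id] only needs [0 < 'V_N01[id] < +oo], so the moments of the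
   normal law are never computed. *)
Lemma gaussian_standard1 : exists X : RT -> 'cV[R]_1, gaussian_vector N01 X 0 1%:M.
Proof.
have v0 := variance_normal_gt0.
have id2 := @Lfun2_normal_prob R.
pose v := fine 'V_N01[(id : RT -> R)]%E.
pose e := fine 'E_N01[(id : RT -> R)]%E.
have vE : 'V_N01[(id : RT -> R)]%E = v%:E by rewrite fineK// variance_fin_num.
have eE : 'E_N01[(id : RT -> R)]%E = e%:E.
  rewrite fineK// expectation_fin_num//; apply: Lfun_subset12 id2.
  exact: fin_num_measure.
have {}v0 : 0 < v by rewrite -lte_fin -vE.
have g : gaussian_vector N01 (fun t : RT => const_mx t : 'cV[R]_1)
    (const_mx e) (const_mx v).
  split.
  - by move=> i; under eq_fun do rewrite mxE; exact: measurable_id.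
  - move=> u; exists (u 0 0 * 0 + 0), (u 0 0 * 1) => A mA.
    rewrite -normal_law_affine// normal_lawE ?oner_eq0//.
    by congr (normal_prob _ _ _); apply/funext => t; rewrite /= !mxE big_ord1 !mxE addr0.
  - by move=> i; rewrite mxE -eE; congr expectation; apply/funext => t; rewrite mxE.
  - by move=> i j; rewrite mxE -vE /variance; congr covariance;
      apply/funext => t; rewrite mxE.
pose c := (Num.sqrt v)^-1.
have gB := gaussian_affine g (c%:M : 'M[R]_1) (- (c%:M *m const_mx e)).
exists (fun t : RT => c%:M *m const_mx t - c%:M *m const_mx e).
rewrite subrr in gB; move: gB; congr gaussian_vector.
apply/matrixP => i j; rewrite !ord1 tr_scalar_mx mul_scalar_mx mul_mx_scalar !mxE/= mulr1n.
by rewrite mulrA /c -invfM -expr2 sqr_sqrtr ?ltW// mulVf// gt_eqF.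
Qed.

(** Each induction step adjoins one independent coordinate on a product space; in dimension 0 every
    functional is 0, whose law is the point mass. *)
Lemma gaussian_standard n : exists (d : measure_display) (T : measurableType d)
  (Pr : probability T R) (X : T -> 'cV[R]_n), gaussian_vector Pr X 0 1%:M.
Proof.
elim: n => [|n [d [T [Pr [X gX]]]]].
  exists _, RT, (@dirac _ RT 0 R), (fun=> 0); split => [[]//|u|[]//|[]//].
  by exists 0, 0 => A mA; rewrite mulmx0 mxE normal_law0.
have [Y gY] := gaussian_standard1.
have := gaussian_product gY gX; rewrite col_mx0 -scalar_mx_block => gYX.
by exists _, _, (N01 \x Pr)%E, (fun w => col_mx (Y w.1) (X w.2)).
Qed.
End standard.

Lemma gaussian_exists (R : realType) n (m : 'cV[R]_n) (B : 'M[R]_n) :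
  exists (d : measure_display) (T : measurableType d)
    (Pr : probability T R) (X : T -> 'cV[R]_n), gaussian_vector Pr X m (B *m B^T).
Proof.
have [d [T [Pr [X gX]]]] := gaussian_standard R n.
have := gaussian_affine gX B m; rewrite mulmx0 add0r mulmx1 => gBX.
by exists d, T, Pr, (fun t => B *m X t + m).
Qed.

(** * Almost sure equality of two coordinates *)

Section gaussian_coordinates.
Context d (T : measurableType d) (R : realType) (Pr : probability T R) (n : nat).
Variables (X : T -> 'cV[R]_n) (m : 'cV[R]_n) (S : 'M[R]_n).
Hypothesis gX : gaussian_vector Pr X m S.

Lemma gaussian_ae_eq_mean i j : {ae Pr, forall t, X t i 0 = X t j 0} -> m i 0 = m j 0.
Proof.
case: (gX) => mX _ EX _ ae_ij; apply: EFin_inj; rewrite -!EX unlock.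
apply: ae_eq_integral => //; try by apply/measurable_EFinP; exact: mX.
by apply: filterS ae_ij => t -> _.
Qed.

(** The expression in [S] is the variance of the difference of the two coordinates, and that
    difference has mean 0. *)
Lemma gaussian_eq_ae i j : m i 0 = m j 0 -> S i i + S j j - 2 * S i j = 0 ->
  {ae Pr, forall t, X t i 0 = X t j 0}.
Proof.
case: (gX) => mX _ EX CX mij Sij.
have X2 := gaussian_Lfun2 gX.
have Pfin : Pr [set: T] \is a fin_num := fin_num_measure Pr _ measurableT.
have D2 : (fun t => X t i 0) \- (fun t => X t j 0) \in Lfun Pr 2%:E.
  by rewrite rpredB ?lee1n//.
have V0 : 'V_Pr[((fun t => X t i 0) \- (fun t => X t j 0))%R]%E = 0%E.
  rewrite varianceB// /variance !CX; exact: (congr1 EFin Sij).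
have := variance_eq0_ae D2 V0.
rewrite expectationB ?Lfun_subset12// !EX mij subee//=.
by apply: filterS => t /eqP; rewrite subr_eq0 => /eqP.
Qed.

End gaussian_coordinates.

(** * Gaussian tensors with covariance [power_mean P K]: existence and invariance *)

Theorem theorem4p5 (R : realType) (J D K : nat) (P : 'M[R]_(J ^ D))
    (hP : is_perm_mx P) (hK : has_order P K) (w0 : 'cV[R]_(J ^ D)) :
  (exists (d : measure_display) (T : measurableType d) (Pr : probability T R)
     (W : T -> tensor R J D), gaussian_tensor Pr W w0 (power_mean P K)) /\
  (forall (d : measure_display) (T : measurableType d) (Pr : probability T R)
     (W : T -> tensor R J D),
     gaussian_tensor Pr W w0 (power_mean P K) ->
     ({ae Pr, forall t : T, invariant_tensor P (W t)} <->
      invariant_vector P w0)).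
Proof.
case: hK => K0 PK _.
split.
  have [d [T [Pr [X gX]]]] := gaussian_exists w0 (power_mean P K).
  (* The projection is its own square root here, and a chosen right inverse of [vec] lifts the
     vector to a tensor. *)
  rewrite mul_tr_power_mean// in gX; have [W WX] := choice (@vec_surj R J D).
  exists d, T, Pr, (W \o X); rewrite /gaussian_tensor.
  by under eq_fun do rewrite /= WX.
move=> d T Pr W gW; have /is_perm_mxP[s Ps] := hP.
have Pw p (B : 'M[R]_(J ^ D, p)) i j : (P *m B) i j = B (s i) j.
  by rewrite Ps -row_permE mxE.
split=> [inv|inv].
  apply/colP => i; rewrite Pw; apply: (gaussian_ae_eq_mean gW).
  by apply: filterS inv => t /colP/(_ i); rewrite Pw.
(* With symmetry, invariance under [s] in the row index passes to the column index, so all three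
   entries in the variance of the difference equal the entry at [i, i]. *)
have Acol i j : power_mean P K (s i) j = power_mean P K i j.
  by rewrite -[in RHS](mul_power_mean K0 PK) Pw.
have Asym i j : power_mean P K i j = power_mean P K j i.
  by rewrite -[in LHS](tr_power_mean K0 PK hP) mxE.
have : {ae Pr, forall t, forall i, vec (W t) (s i) 0 = vec (W t) i 0}.
  (* There are finitely many coordinates, so the exceptional null sets can be united. *)
  apply: filter_forall => i; apply: (gaussian_eq_ae gW).
    by rewrite -[in RHS]inv Pw.
  by rewrite Acol Asym Acol; ring.
by apply: filterS => t Wt; apply/colP => i; rewrite Pw Wt.
Qed.
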